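(* Every Dedekind domain is a sharp domain.
   Context: All rings are integral domains (commutative, unitary, without zero-divisors). A domain $D$ is called a sharp domain if whenever $I \supseteq AB$ with $I, A, B$ nonzero ideals of $D$, there exist ideals $A' \supseteq A$ and $B' \supseteq B$ of $D$ such that $I = A'B'$. *)

(* Defs.v *)
From HB Require Import structures.
From mathcomp Require Import all_boot all_order all_algebra.
From mathcomp Require Import fraction.
From mathcomp Require Import mathcomp_extra boolp classical_sets functions.
From mathcomp Require Import cardinality.

Set Implicit Arguments.
Unset Strict Implicit.
Unset Printing Implicit Defensive.

Import GRing.Theory.

Local Open Scope classical_set_scope.
Local Open Scope ring_scope.

(* Ideals are subsets of the ring, the zero ideal and the whole ring included.
   The predicate [idealr_closed] of ring_quotient is not used because it
   imposes [1 \notin I]. *)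
Definition is_ideal (D : idomainType) (I : set D) : Prop :=
  [/\ I 0, (forall x y, I x -> I y -> I (x + y))
    & (forall r x, I x -> I (r * x))].

Definition ideal_gen (D : idomainType) (S : set D) : set D :=
  smallest (@is_ideal D) S.

Definition ideal_mul (D : idomainType) (A B : set D) : set D :=
  ideal_gen [set a * b | a in A & b in B].

Definition nonzero_ideal (D : idomainType) (I : set D) : Prop :=
  is_ideal I /\ I <> [set 0].

Definition prime_ideal (D : idomainType) (P : set D) : Prop :=
  [/\ is_ideal P, ~ P 1 & forall x y, P (x * y) -> P x \/ P y].

Definition maximal_ideal (D : idomainType) (M : set D) : Prop :=
  [/\ is_ideal M, M <> setT
    & forall J, is_ideal J -> M `<=` J -> J = M \/ J = setT].

Definition noetherian (D : idomainType) : Prop :=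
  forall I : set D, is_ideal I ->
    exists S : set D, finite_set S /\ I = ideal_gen S.

Definition integrally_closed (D : idomainType) : Prop :=
  forall u : {fraction D},
    integralOver (@tofrac D) u -> exists a : D, u = tofrac a.

(* Fields are Dedekind domains under this definition. *)
Definition dedekind_domain (D : idomainType) : Prop :=
  [/\ noetherian D, integrally_closed D
    & forall P : set D, prime_ideal P -> P <> [set 0] -> maximal_ideal P].

(* A' and B' are automatically nonzero, since they contain A and B. *)
Definition sharp_domain (D : idomainType) : Prop :=
  forall I A B : set D,
    nonzero_ideal I -> nonzero_ideal A -> nonzero_ideal B ->
    ideal_mul A B `<=` I ->
    exists A' B' : set D,
      [/\ is_ideal A', is_ideal B', A `<=` A', B `<=` B'
        & I = ideal_mul A' B'].

(* Main.v *)
Require Import Defs.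
From mathcomp Require Import all_boot all_order all_algebra.
From mathcomp Require Import fraction boolp classical_sets cardinality.

(** Containment is division for nonzero ideals of a Dedekind domain: if A' is
    nonzero and I is contained in A', then I = A' (I : A').  Sharpness follows
    at once.  Given I containing AB, take A' = I + A and B' = (I : A'); then
    I = A'B', and B lies in (I : A') because BI and BA both lie in I.

    Containment is division because every nonzero ideal I is invertible: for
    nonzero a in I, the ideal J = (aD : I) satisfies a \in IJ.  To see it, let
    A = (IJ : a), the ideal IJ / a.  If A were proper, some fraction b/c outside
    D would map A into D ([fraction_into_ring]).  One checks that b/c then maps
    J into itself, so b/c is integral over D because J is finitely generated
    ([stable_fraction_in_ring]), and so b/c lies in D, a contradiction.

    The fraction b/c is where dimension one enters.  A proper nonzero ideal lies
    in a maximal ideal P; for a nonzero c in P, an ideal (cD : b) maximal among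
    those contained in P is prime ([maximal_colon_prime]) and contains c, so it
    is P itself.  Thus bP is contained in cD while b is not in cD.

    Fractions b/c are handled as pairs of elements of D, except in the
    determinant argument for integrality. *)

Set Implicit Arguments.
Unset Strict Implicit.
Unset Printing Implicit Defensive.

Import GRing.Theory.
Local Open Scope classical_set_scope.
Local Open Scope ring_scope.

(** * Ideals, colon ideals and finite generation *)

Section IdealArithmetic.
Variable D : idomainType.
Implicit Types (I J A B P S : set D) (a b c x : D).

Definition principal a : set D := [set x | exists r, x = a * r].

Definition colon I S : set D := [set r | forall s, S s -> I (r * s)].

Lemma principal_ideal a : is_ideal (principal a).
Proof.
split=> [|x y [r ->] [s ->]|r x [s ->]].
- by exists 0; rewrite mulr0.
- by exists (r + s); rewrite mulrDr.
- by exists (r * s); rewrite mulrCA.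
Qed.

Lemma colon_ideal I S : is_ideal I -> is_ideal (colon I S).
Proof.
case=> I0 ID IM; split=> [s _|x y Ix Iy s Ss|r x Ix s Ss].
- by rewrite mul0r.
- by rewrite mulrDl; apply: ID; [apply: Ix|apply: Iy].
- by rewrite -mulrA; apply: IM; apply: Ix.
Qed.

Lemma ideal_mulr I x r : is_ideal I -> I x -> I (x * r).
Proof. by case=> _ _ IM Ix; rewrite mulrC; apply: IM. Qed.

Lemma colon_sub_id I S : is_ideal I -> I `<=` colon I S.
Proof. by move=> hI x Ix s _; apply: ideal_mulr. Qed.

Lemma ideal_gen_ideal S : is_ideal (ideal_gen S).
Proof.
split=> [J [[] //]|x y Sx Sy J [hJ SJ]|r x Sx J [hJ SJ]].
- by case: (hJ) => _ JD _; apply: JD; [apply: Sx|apply: Sy].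
- by case: (hJ) => _ _; apply; apply: Sx.
Qed.

Lemma ideal_gen_sub S I : is_ideal I -> S `<=` I -> ideal_gen S `<=` I.
Proof. exact: smallest_sub. Qed.

Lemma sub_ideal_gen S : S `<=` ideal_gen S.
Proof. exact: sub_gen_smallest. Qed.

Lemma mem_ideal_mul A B x y : A x -> B y -> ideal_mul A B (x * y).
Proof. by move=> Ax By; apply: sub_ideal_gen; exists x => //; exists y. Qed.

Lemma ideal_mul_sub A B I : is_ideal I ->
  (forall x y, A x -> B y -> I (x * y)) -> ideal_mul A B `<=` I.
Proof.
by move=> hI AB; apply: ideal_gen_sub => // _ [x Ax [y By <-]]; apply: AB.
Qed.

Lemma nonzero_ideal_elt I : nonzero_ideal I -> exists2 a, I a & a != 0.
Proof.
case=> [[I0 _ _] In0]; apply: contrapT => nI; apply: In0.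
apply/seteqP; split=> [x Ix|_ -> //].
by apply: contrapT => /eqP x0; apply: nI; exists x.
Qed.

Lemma nonzero_ideal_of_elt I a : is_ideal I -> I a -> a != 0 -> nonzero_ideal I.
Proof. by move=> hI Ia /eqP a0; split=> // I0; move: Ia; rewrite I0. Qed.

Lemma ideal_gen_seq (s : seq D) x : ideal_gen [set` s] x ->
  exists f : 'I_(size s) -> D, x = \sum_i f i * s`_i.
Proof.
move=> sx; pose L := [set x | exists f : 'I_(size s) -> D,
  x = \sum_i f i * s`_i].
apply: (_ : ideal_gen [set` s] `<=` L) sx; apply: ideal_gen_sub => [|y].
  split=> [|y z [f ->] [g ->]|r y [f ->]].
  - by exists (fun=> 0); rewrite big1 // => i _; rewrite mul0r.
  - exists (fun i => f i + g i); rewrite -big_split /=.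
    by apply: eq_bigr => i _; rewrite mulrDl.
  - exists (fun i => r * f i); rewrite mulr_sumr.
    by apply: eq_bigr => i _; rewrite mulrA.
move=> /= ys; have yi : (index y s < size s)%N by rewrite index_mem.
exists (fun i => (i == Ordinal yi)%:R); rewrite (bigD1 (Ordinal yi)) //= eqxx.
by rewrite mul1r nth_index // big1 ?addr0 // => i /negPf ->; rewrite mul0r.
Qed.

(** If y is not in P, then (P : y) is a proper ideal containing P, hence equal
    to P by maximality; so xy in P forces x in P. *)
Lemma maximal_ideal_prime P : maximal_ideal P -> prime_ideal P.
Proof.
move=> [hP PT maxP]; split=> // [P1|x y Pxy].
  apply: PT; apply/seteqP; split=> // x _.
  by rewrite -[x]mulr1; case: hP => _ _; apply.
apply: contrapT => /not_orP[nPx nPy].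
have hQ := colon_ideal [set y] hP.
have [QP|QT] := maxP _ hQ (colon_sub_id (S:=[set y]) hP).
- by apply: nPx; rewrite -QP => _ ->.
- apply: nPy; rewrite -[y]mul1r.
  by have : [set: D] 1 by []; rewrite -QT; apply.
Qed.

(** * Maximal elements in noetherian rings *)

Lemma finite_sub_chain (C : set (set D)) X0 (s : seq D) :
  total_on C subset -> C X0 ->
  [set` s] `<=` \bigcup_(X in C) X ->
  exists X, [/\ C X, X0 `<=` X & [set` s] `<=` X].
Proof.
move=> totC CX0; elim: s => [|x s IHs] sC; first by exists X0; split=> // y.
have [|X [CX X0X sX]] := IHs.
  by move=> y /= ys; apply: sC; rewrite /= inE ys orbT.
have [|Y CY Yx] := sC x; first by rewrite /= mem_head.
have [XY|YX] := totC _ _ CX CY.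
- exists Y; split=> // [y /X0X /XY //|y /=].
  by rewrite inE => /predU1P[-> //|/sX /XY].
- exists X; split=> // y /=.
  by rewrite inE => /predU1P[-> |/sX //]; apply: YX.
Qed.

(** In a noetherian ring the union of a chain of ideals is finitely generated,
    hence belongs to the chain, so Zorn's lemma applies to any family. *)
Lemma noetherian_maximal (F : set (set D)) I0 : noetherian D ->
  (forall I, F I -> is_ideal I) -> F I0 ->
  exists2 M, F M & forall J, F J -> M `<=` J -> J `<=` M.
Proof.
move=> noethD Fideal FI0.
(* The empty set is adjoined to F as an upper bound of the empty chain. *)
have [C CP totC|M [PM maxM]] := @Zorn_bigcup D [set X | X = set0 \/ F X].
  have [[X0 CX0 FX0]|noF] := pselect (exists2 X0, C X0 & F X0); last first.
    left; apply/seteqP; split=> // x [X CX Xx].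
    have [X_0|FX] := CP _ CX; first by rewrite X_0 in Xx.
    by case: noF; exists X.
  right; have C0 X : C X -> X !=set0 -> is_ideal X.
    by move=> CX [x Xx]; have [X_0|/Fideal//] := CP _ CX; rewrite X_0 in Xx.
  have hU : is_ideal (\bigcup_(X in C) X).
    split=> [|x y [X CX Xx] [Y CY Yy]|r x [X CX Xx]].
    - by exists X0 => //; case: (Fideal _ FX0).
    - have [XY|YX] := totC _ _ CX CY.
      + exists Y => //; have [_ + _] : is_ideal Y by apply: C0 => //; exists y.
        by apply => //; apply: XY.
      + exists X => //; have [_ + _] : is_ideal X by apply: C0 => //; exists x.
        by apply => //; apply: YX.
    - exists X => //; have [_ _] : is_ideal X by apply: C0 => //; exists x.
      exact.
  have [S [/finite_seqP[s ->] Us]] := noethD _ hU.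
  have [|X [CX X0X sX]] := finite_sub_chain totC CX0 (s := s).
    by rewrite Us; apply: sub_ideal_gen.
  have X0_ : X 0 by apply: X0X; case: (Fideal _ FX0).
  have hX : is_ideal X by apply: C0 => //; exists 0.
  have -> : \bigcup_(X in C) X = X.
    apply/seteqP; split; last by move=> x Xx; exists X.
    by rewrite Us; apply: ideal_gen_sub.
  by have [X_0|//] := CP _ CX; rewrite X_0 in X0_.
have FM : F M.
  case: PM => // M0; exfalso; apply: (maxM I0); last by right.
  by rewrite M0; split=> // /(_ 0); apply; case: (Fideal _ FI0).
exists M => // J FJ MJ; apply: contrapT => nJM.
by apply: (maxM J); [split | right].
Qed.

Lemma proper_sub_maximal I : noetherian D -> is_ideal I -> ~ I 1 ->
  exists2 P, maximal_ideal P & I `<=` P.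
Proof.
move=> noethD hI I1.
have [||M [hM M1 IM] maxM] := @noetherian_maximal
  [set J | [/\ is_ideal J, ~ J 1 & I `<=` J]] I noethD.
- by move=> J [].
- by split=> // x.
exists M => //; split=> // [MT|J hJ MJ]; first by apply: M1; rewrite MT.
have [J1|nJ1] := pselect (J 1); [right|left].
- apply/seteqP; split=> // x _; rewrite -[x]mulr1.
  by case: hJ => _ _; apply.
- apply/seteqP; split=> //; apply: maxM => //; split=> //.
  exact: subset_trans IM MJ.
Qed.

(** * Invertibility of ideals in Dedekind domains *)

(** Suppose xy is in Q = (aD : b) but neither x nor y is.  The strictly larger
    ideal (aD : bx) contains some s outside P, so sx is in Q.  Then (aD : bs)
    contains x, hence also some t outside P, and ts is in Q, so in P: this
    contradicts the primality of P. *)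
Lemma maximal_colon_prime P a b : prime_ideal P ->
  colon (principal a) [set b] `<=` P ->
  (forall c, colon (principal a) [set c] `<=` P ->
     colon (principal a) [set b] `<=` colon (principal a) [set c] ->
     colon (principal a) [set c] `<=` colon (principal a) [set b]) ->
  prime_ideal (colon (principal a) [set b]).
Proof.
move=> [hP P1 primeP]; have ha := principal_ideal a.
set Q := colon _ _ => QP maxQ.
have QE r : Q r <-> principal a (r * b).
  by split=> [/(_ _ erefl)//|Qr _ ->].
have step r z : Q (z * r) -> ~ Q z -> exists2 s, ~ P s & Q (s * r).
  move=> Qzr nQz; apply: contrapT => noS.
  apply: nQz; apply: (maxQ (b * r)).
  - move=> s Qs; apply: contrapT => nPs; apply: noS; exists s => //.
    by apply/QE; rewrite mulrAC -mulrA; apply: Qs.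
  - move=> s /QE Qs _ ->; rewrite mulrA; exact: ideal_mulr.
  - by move=> _ ->; rewrite [b * r]mulrC mulrA; apply/QE.
split=> [||x y Qxy]; first exact: colon_ideal.
- by move/QP.
apply: contrapT => /not_orP[nQx nQy].
have [//|s nPs Qsx] := step x y _ nQy; first by rewrite mulrC.
have [//|t nPt /QP Pts] := step s x _ nQx; first by rewrite mulrC.
by have [] := primeP _ _ Pts.
Qed.

(** The witnesses are c in I and b with (cD : b) = P for a maximal ideal P
    containing I.  That c lies in every (cD : b) is what makes the prime ideal
    found below P nonzero, hence maximal. *)
Lemma fraction_into_ring I : dedekind_domain D -> nonzero_ideal I -> ~ I 1 ->
  exists c b, [/\ c != 0, ~ principal c b
    & forall x, I x -> principal c (b * x)].
Proof.
move=> [noethD _ dim1] nzI I1; have [hI _] := nzI.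
have [c Ic c0] := nonzero_ideal_elt nzI.
have [P maxP IP] := proper_sub_maximal noethD hI I1.
have primeP := maximal_ideal_prime maxP; have [hP P1 _] := primeP.
have hc := principal_ideal c.
have [||_ [[b _ <-] QP] maxQ] := @noetherian_maximal
  ([set colon (principal c) [set b] | b in setT] `&` [set Q | Q `<=` P])
  (colon (principal c) [set 1]) noethD.
- by move=> _ [[b _ <-] _]; apply: colon_ideal.
- split; first by exists 1.
  move=> r /(_ _ erefl); rewrite mulr1 => -[s ->].
  by apply: ideal_mulr => //; apply: IP.
have primeQ : prime_ideal (colon (principal c) [set b]).
  apply: (maximal_colon_prime primeP QP) => e eP.
  by apply: maxQ; split=> //; exists e.
have Qc : colon (principal c) [set b] c by move=> _ ->; exists b.
have [|_ _ /(_ _ hP QP)[PQ|PT]] := dim1 _ primeQ.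
- by move=> Q0; move: Qc; rewrite Q0 => /= /eqP; apply/negP.
- exists c, b; split=> // [cb|x /IP].
  + by apply: P1; apply: QP => _ ->; rewrite mul1r.
  + by rewrite PQ mulrC => /(_ _ erefl).
- by case: P1; rewrite PT.
Qed.

(** The determinant trick: b/c is an eigenvalue of the matrix, over D, of
    multiplication by b/c on generators of J, hence a root of its monic
    characteristic polynomial. *)
Lemma stable_fraction_in_ring J b c : noetherian D -> integrally_closed D ->
  nonzero_ideal J -> c != 0 ->
  (forall j, J j -> exists2 k, J k & b * j = c * k) -> principal c b.
Proof.
move=> noethD closedD nzJ c0 stabJ; have [hJ _] := nzJ.
have [S [/finite_seqP[s ->] Js]] := noethD _ hJ.
have gen i : exists f : 'I_(size s) -> D,
    b * s`_(i : 'I_(size s)) = c * \sum_j f j * s`_j.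
  have [|k + ->] := stabJ s`_i; last first.
    by rewrite Js => /ideal_gen_seq[f ->]; exists f.
  by rewrite Js; apply: sub_ideal_gen; apply: mem_nth.
have [f fE] := choice gen.
pose M : 'M[D]_(size s) := \matrix_(i, j) f j i.
pose v : 'rV[{fraction D}]_(size s) := \row_i tofrac s`_i.
have c0' : tofrac c != 0 by rewrite tofrac_eq0.
have [d bd] : exists d, tofrac b / tofrac c = tofrac d.
  apply: closedD; exists (char_poly M); first exact: char_poly_monic.
  rewrite map_char_poly -eigenvalue_root_char; apply/eigenvalueP; exists v.
    apply/rowP => i; rewrite !mxE; apply: (mulfI c0').
    rewrite [RHS]mulrA [tofrac c * (_ / _)]mulrC divfK //.
    rewrite -tofracM fE tofracM rmorph_sum; congr (_ * _).
    by apply: eq_bigr => j _; rewrite !mxE -tofracM mulrC.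
  have [x Jx x0] := nonzero_ideal_elt nzJ.
  apply: contraNneq x0 => v0.
  move: Jx; rewrite Js => /ideal_gen_seq[g ->].
  rewrite big1 // => i _; have /rowP/(_ i) := v0.
  by rewrite !mxE => /eqP; rewrite tofrac_eq0 => /eqP ->; rewrite mulr0.
exists d; apply/eqP; rewrite -tofrac_eq tofracM -bd mulrC divfK //.
Qed.

Lemma dedekind_ideal_invertible I a : dedekind_domain D -> is_ideal I ->
  I a -> a != 0 -> ideal_mul I (colon (principal a) I) a.
Proof.
move=> dedD hI Ia a0; have [noethD closedD _] := dedD.
set J := colon _ _; set IJ := ideal_mul _ _.
have hJ : is_ideal J by apply/colon_ideal/principal_ideal.
have Ja : J a by move=> x _; exists x.
have hIJ : is_ideal IJ := ideal_gen_ideal _.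
have IJa x : IJ x -> principal a x.
  move: x; apply: ideal_mul_sub; first exact: principal_ideal.
  by move=> x y Ix Jy; rewrite mulrC; apply: Jy.
pose A := colon IJ [set a]; have hA : is_ideal A by apply: colon_ideal.
have AE r : A r <-> IJ (r * a) by split=> [/(_ _ erefl)//|Ar _ ->].
have [/AE|nA1] := pselect (A 1); first by rewrite mul1r.
have nzA : nonzero_ideal A.
  by apply: nonzero_ideal_of_elt hA _ a0; apply/AE; apply: mem_ideal_mul.
(* Multiplication by b/c preserves J: for j in J and i in I, aj is in IJ, so j
   is in A and bj = ck; and ij = ar with r in A, so br = ct, which gives
   ki = at, that is, k is in J. *)
have [c [b [c0 ncb bA]]] := fraction_into_ring dedD nzA nA1.
case: ncb; apply: (@stable_fraction_in_ring J b c) => //.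
  exact: nonzero_ideal_of_elt Ja a0.
move=> j Jj.
have [|k kE] := bA j.
  by apply/AE; rewrite mulrC; apply: mem_ideal_mul.
exists k => // i Ii.
have IJij : IJ (i * j) by apply: mem_ideal_mul.
have [r rE] := IJa _ IJij.
have [|t tE] := bA r; first by apply/AE; rewrite mulrC -rE.
exists t; apply: (mulfI c0); rewrite mulrA -kE mulrCA -tE mulrCA -rE.
by rewrite mulrA mulrAC.
Qed.

(** Invertibility supplies a in AJ with J = (aD : A).  For x in I and j in J,
    jx is divisible by a because x is in A, and the quotient jx/a is in (I : A)
    because jA is contained in aD. *)
Lemma dedekind_contain_divide I A : dedekind_domain D -> is_ideal I ->
  nonzero_ideal A -> I `<=` A -> I = ideal_mul A (colon I A).
Proof.
move=> dedD hI nzA IA; have [hA _] := nzA.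
have [a Aa a0] := nonzero_ideal_elt nzA.
apply/seteqP; split; last first.
  by apply: ideal_mul_sub => // x y Ax Cy; rewrite mulrC; apply: Cy.
move=> x Ix; set AC := ideal_mul _ _.
have hAC : is_ideal AC := ideal_gen_ideal _.
(* Since a is in AJ, it is enough that x AJ lies in a A(I : A): then ax does, and
   a can be cancelled. *)
pose L := colon [set a * w | w in AC] [set x].
have hL : is_ideal L.
  apply: colon_ideal; case: hAC => AC0 ACD ACM.
  split=> [|_ _ [y ACy <-] [z ACz <-]|r _ [y ACy <-]].
  - by exists 0; rewrite ?mulr0.
  - by exists (y + z); [apply: ACD|rewrite mulrDr].
  - by exists (r * y); [apply: ACM|rewrite mulrCA].
have : L a.
  apply: ideal_mul_sub (dedekind_ideal_invertible dedD hA Aa a0) => //.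
  move=> y j Ay Jj _ ->; have [k kE] := Jj _ (IA _ Ix).
  exists (y * k); last by rewrite mulrCA -kE mulrA.
  apply: mem_ideal_mul => // z Az; have [t tE] := Jj _ Az.
  have -> : k * z = t * x; last by case: hI => _ _; apply.
  by apply: (mulfI a0); rewrite !mulrA -kE -tE mulrAC.
by move=> /(_ _ erefl)[w ACw /(mulfI a0) <-].
Qed.

End IdealArithmetic.

Theorem corollary3 (D : idomainType) (hD : dedekind_domain D) :
  sharp_domain D.
Proof.
move=> I A B nzI nzA nzB ABI; have [hI _] := nzI.
have [a Aa a0] := nonzero_ideal_elt nzA.
pose A' := ideal_gen (I `|` A).
have hA' : is_ideal A' := ideal_gen_ideal _.
have AA' : A `<=` A' by move=> x Ax; apply: sub_ideal_gen; right.
have IA' : I `<=` A' by move=> x Ix; apply: sub_ideal_gen; left.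
exists A', (colon I A'); split=> //; first exact: colon_ideal.
- move=> b Bb x A'x; rewrite mulrC.
  suff : colon I [set b] x by apply.
  apply: ideal_gen_sub A'x; first exact: colon_ideal.
  move=> y [Iy|Ay] _ ->; first exact: ideal_mulr.
  by apply: ABI; apply: mem_ideal_mul.
- apply: dedekind_contain_divide => //.
  exact: nonzero_ideal_of_elt (AA' _ Aa) a0.
Qed.
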